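(* Let $J$ and $R$ be anti-commuting fundamental symmetries in a Hilbert space $\mathfrak{H}$ and let $S$ be a simple, densely defined symmetric operator in $\mathfrak{H}$ with defect numbers $\langle 2,2\rangle$ such that $[S,J]=[S,R]=0$. Assume that the set $\Upsilon$ is non-empty. Then the collection $\{C_\alpha\}_{\alpha\in D}$ of all $C$-symmetries of $S$ in the Krein space $(\mathfrak{H},[\cdot,\cdot]_J)$ coincides with the set of operators $$C_{\chi,\omega}=Je^{\chi R_\omega}=J[(\cosh\chi)I+(\sinh\chi)R_\omega],\qquad R_\omega=Re^{i\omega J}=R[\cos\omega+i(\sin\omega)J],$$ where $\chi\in\mathbb{R}$ and $\omega\in[0,2\pi)$.
   Context: $\mathfrak{H}$ is a Hilbert space with inner product $(\cdot,\cdot)$, and $[x,y]_J=(Jx,y)$. A fundamental symmetry is a bounded operator $J$ with $J=J^*$, $J^2=I$; $J,R$ anti-commute if $JR+RJ=0$. For a bounded operator $C$ and an operator $A$, $[A,C]=0$ means $AC=CA$ (including equality of domains). $\{C_\alpha\}_{\alpha\in D}$ denotes the set (indexed by a set $D$) of all bounded operators $C$ in $\mathfrak{H}$ with $C^2=I$, $JC>0$ (i.e. $JC$ is self-adjoint and $(JCx,x)>0$ for $x\neq0$) and $SC=CS$. An operator $A$ is $J$-self-adjoint if it is densely defined and $A^*J=JA$. $\Sigma_J$ is the set of $J$-self-adjoint extensions $A\supset S$, and $\Upsilon=\{A\in\Sigma_J : [A,C_\alpha]=0\ \ \forall\alpha\in D\}$. $S$ is simple if the closed linear span of $\bigcup_{\mu\in\mathbb{C}\setminus\mathbb{R}}\ker(S^*-\mu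 I)$ is $\mathfrak{H}$. Defect numbers $\langle2,2\rangle$ means $\dim\ker(S^*-\mu I)=2$ for all $\mu\in\mathbb{C}\setminus\mathbb{R}$. *)

(* Defs.v *)
From mathcomp Require Export all_boot all_order all_algebra.
From mathcomp Require Export complex.
From mathcomp Require Export all_classical all_reals all_analysis.

Set Implicit Arguments.
Unset Strict Implicit.
Unset Printing Implicit Defensive.

Export Order.TTheory GRing.Theory Num.Theory.
Export numFieldNormedType.Exports.

Local Open Scope classical_set_scope.
Local Open Scope ring_scope.
Local Open Scope complex_scope.

(* Hilbert spaces over the complex numbers K[i] (K : realType) are presented as
   H : completeNormedModType K[i] together with an inner product
   ip : {dot H for Num.conj}, linear in its first argument and conjugate-linear
   in the second, that induces the norm of H. *)
Definition hilbert (K : realType) (H : completeNormedModType K[i])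
    (ip : {dot H for (@Num.conj K[i])}) : Prop :=
  forall x : H, `|x| ^+ 2 = ip x x.

Section Operators.
Variables (K : realType) (H : completeNormedModType K[i]).
Variable ip : {dot H for (@Num.conj K[i])}.
Implicit Types (A B : set (H * H)) (T C J R : H -> H).

(* A (possibly unbounded) operator is represented by its graph
   {(x, A x) | x in D(A)}, so that equality of graphs is equality of operators
   including equality of domains. *)
Definition is_operator A : Prop :=
  [/\ A (0, 0),
      forall (a : K[i]) (p q : H * H), A p -> A q ->
        A (a *: p.1 + q.1, a *: p.2 + q.2)
    & forall x y z, A (x, y) -> A (x, z) -> y = z].

Definition dom A : set H := [set x | exists y, A (x, y)].

Definition graph T : set (H * H) := [set p | p.2 = T p.1].

Definition op_comp A B : set (H * H) :=
  [set p | exists2 y, B (p.1, y) & A (y, p.2)].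

Definition bounded_op T : Prop :=
  linear T /\ exists M : K, forall x, `|T x| <= M%:C * `|x|.

Definition commute A C : Prop := op_comp A (graph C) = op_comp (graph C) A.

Definition densely_defined A : Prop := closure (dom A) = setT.

(* [(y, z) \in A^*] iff [(A x, y) = (x, z)] for all x in D(A); this is the graph
   of an operator when A is densely defined. *)
Definition adjoint A : set (H * H) :=
  [set q | forall p, A p -> ip p.2 q.1 = ip p.1 q.2].

Definition symmetric_op A : Prop :=
  is_operator A /\ forall p q, A p -> A q -> ip p.2 q.1 = ip p.1 q.2.

Definition fundamental_symmetry J : Prop :=
  [/\ bounded_op J, adjoint (graph J) = graph J & J \o J = id].

Definition anticommute J R : Prop := forall x, J (R x) + R (J x) = 0.

Definition positive_op T : Prop :=
  adjoint (graph T) = graph T /\ forall x, x != 0 -> 0 < ip (T x) x.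

Definition C_symmetries J (S : set (H * H)) : set (H -> H) :=
  [set C | [/\ bounded_op C, C \o C = id, positive_op (J \o C) & commute S C]].

Definition J_self_adjoint J A : Prop :=
  [/\ is_operator A, densely_defined A
    & op_comp (adjoint A) (graph J) = op_comp (graph J) A].

Definition Sigma_J J (S : set (H * H)) : set (set (H * H)) :=
  [set A | J_self_adjoint J A /\ S `<=` A].

Definition Upsilon J (S : set (H * H)) : set (set (H * H)) :=
  [set A | Sigma_J J S A /\ forall C, C_symmetries J S C -> commute A C].

Definition eigen_ker A (mu : K[i]) : set H := [set x | A (x, mu *: x)].

Definition lin_span (X : set H) : set H :=
  [set x | exists n (c : 'I_n -> K[i]) (v : 'I_n -> H),
     (forall i, X (v i)) /\ x = \sum_(i < n) c i *: v i].

Definition has_dim (V : set H) (n : nat) : Prop :=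
  exists b : 'I_n -> H,
    V = [set x | exists c : 'I_n -> K[i], x = \sum_(i < n) c i *: b i] /\
    forall c : 'I_n -> K[i], \sum_(i < n) c i *: b i = 0 -> forall i, c i = 0.

Definition simple_op (S : set (H * H)) : Prop :=
  closure (lin_span (\bigcup_(mu in [set mu : K[i] | mu \isn't Num.real])
                       eigen_ker (adjoint S) mu)) = setT.

Definition defect_numbers_2_2 (S : set (H * H)) : Prop :=
  forall mu : K[i], mu \isn't Num.real -> has_dim (eigen_ker (adjoint S) mu) 2.

(* For bounded T the exponential series converges in operator norm; its sum is
   evaluated pointwise here. *)
Definition opexp T : H -> H := fun x =>
  lim ((fun n : nat => \sum_(0 <= k < n) (k`!%:R : K[i])^-1 *: iter k T x) @ \oo).

Definition cosh (t : K) : K := (expR t + expR (- t)) / 2.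
Definition sinh (t : K) : K := (expR t - expR (- t)) / 2.

Definition R_omega J R (omega : K) : H -> H :=
  R \o opexp (fun x => ('i * omega%:C) *: J x).

Definition C_chi_omega J R (chi omega : K) : H -> H :=
  J \o opexp (fun x => chi%:C *: R_omega J R omega x).

End Operators.

(* Main.v *)
(* On each defect space [ker (S^* - mu)], which is two-dimensional, the
   anticommuting involutions [J] and [R] act as Pauli matrices, so [F = J C] is
   there a combination of [1], [J], [R] and [i R J]; positivity of [F] and
   [F J F = J] leave [F = a + c R + d i R J] with [a > 0] and
   [a^2 = 1 + c^2 + d^2].  A member [A] of [Upsilon] commutes with [J] and with
   the C-symmetry [J (5/4 + 3/4 R)], hence with [R], and so it is a self-adjoint
   extension of [S].  The maps [1 + (nu - mu) (A - nu)^-1] between defect spaces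
   are bijective and commute with [J], [R] and [F], so [a], [c], [d] do not
   depend on [mu], and simplicity of [S] propagates the formula to all of [H].
   Finally [a = cosh chi], [c = sinh chi cos omega], [d = sinh chi sin omega]. *)
Require Import Defs.
From mathcomp Require Import ring lra.
Set Implicit Arguments.
Unset Strict Implicit.
Unset Printing Implicit Defensive.
Local Open Scope classical_set_scope.
Local Open Scope ring_scope.
Local Open Scope complex_scope.

(** * Complex scalars and sequences *)

Section ComplexSequences.
Variable K : realType.

(** The order of [K[i]] makes every positive element real; this moves each epsilon, and each squared
    norm, back to [K]. *)
Lemma gt0_complex (e : K[i]) : 0 < e -> exists2 r : K, 0 < r & e = r%:C.
Proof.
move=> e0; have /complex_realP[r er] := gtr0_real e0.
by exists r => //; rewrite -ltcR -er.
Qed.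

Lemma ge0_complex (e : K[i]) : 0 <= e -> exists2 r : K, 0 <= r & e = r%:C.
Proof.
move=> e0; have /complex_realP[r er] := ger0_real e0.
by exists r => //; rewrite -lecR -er.
Qed.

Lemma cvg_real_complex (u : nat -> K) (l : K) :
  u @ \oo --> l -> (fun n => (u n)%:C : K[i]^o) @ \oo --> (l%:C : K[i]^o).
Proof.
move=> /cvgrPdist_lt ul; apply/cvgrPdist_lt => _ /gt0_complex[e e0 ->].
near=> n; rewrite -rmorphB normc_def /= expr0n /= addr0 sqrtr_sqr ltcR.
by near: n; exact: ul.
Unshelve. all: by end_near. Qed.

Lemma near_lt_harmonic (e : K) : 0 < e ->
  \forall n \near \oo, (n.+1%:R^-1 : K) < e.
Proof.
move=> e0; have /cvgrPdist_lt/(_ e e0) := @cvg_harmonic K.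
apply: filterS => n /=; rewrite sub0r normrN ger0_norm ?invr_ge0 ?ler0n //.
Qed.

Lemma complete_seq (H : completeNormedModType K[i]) (u : nat -> H) :
  (forall e : K, 0 < e -> exists N, forall n m, (N <= n)%N -> (N <= m)%N ->
    `|u n - u m| < e%:C) -> exists l : H, u @ \oo --> l.
Proof.
move=> uC; exists (lim (u @ \oo)).
apply: cauchy_cvg; apply: cauchy_exP => _ /gt0_complex[e e0 ->].
have [N uN] := uC e e0; exists (u N); exists N => // n /= Nn.
rewrite -ball_normE /=; exact: uN.
Qed.

End ComplexSequences.

(** * Inner product geometry and approximate projections *)

Section InnerProduct.
Variables (K : realType) (H : completeNormedModType K[i]).
Variable ip : {dot H for (@Num.conj K[i])}.

Lemma ipC x y : ip x y = (ip y x)^*%R.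
Proof. by rewrite hermC /= mul1r. Qed.

Lemma ipDl x y z : ip (x + y) z = ip x z + ip y z.
Proof. by rewrite linearDl. Qed.
Lemma ipDr x y z : ip x (y + z) = ip x y + ip x z.
Proof. by rewrite linearD. Qed.
Lemma ipZl a x z : ip (a *: x) z = a * ip x z.
Proof. by rewrite linearZl_LR. Qed.
Lemma ipZr a x z : ip x (a *: z) = a^*%R * ip x z.
Proof. by rewrite linearZr_LR. Qed.
Lemma ipBl x y z : ip (x - y) z = ip x z - ip y z.
Proof. by rewrite linearBl. Qed.
Lemma ipBr x y z : ip x (y - z) = ip x y - ip x z.
Proof. by rewrite linearB. Qed.
Lemma ipNl x y : ip (- x) y = - ip x y.
Proof. by rewrite linearNl. Qed.
Lemma ip0r x : ip x 0 = 0. Proof. by rewrite linear0. Qed.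

Hypothesis hH : hilbert ip.

(** Squared length of the residual of [x] after projection on the line of [y]. Its non-negativity is
    the Cauchy-Schwarz inequality; it also measures how much a correction along [y] shortens a
    vector. *)
Lemma sqr_norm_sub_proj x y : y != 0 ->
  ip (x - (ip x y / ip y y) *: y) (x - (ip x y / ip y y) *: y) =
  ip x x - `|ip x y| ^+ 2 / ip y y.
Proof.
move=> y0; have d0 : ip y y != 0 by rewrite dnorm_eq0.
have dR : (ip y y)^*%R = ip y y by rewrite -ipC.
rewrite ipBl !ipBr !ipZl !ipZr rmorphM fmorphV /= dR normCK.
rewrite [ip y x]ipC; field; exact: d0.
Qed.

Lemma cauchy_schwarz x y : `|ip x y| <= `|x| * `|y|.
Proof.
have [->|y0] := eqVneq y 0; first by rewrite ip0r !normr0 mulr0.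
rewrite -(@ler_pXn2r _ 2) ?nnegrE ?mulr_ge0 // exprMn !hH.
have d0 : 0 < ip y y by rewrite dnorm_gt0.
rewrite -ler_pdivrMr // -subr_ge0 -sqr_norm_sub_proj //; exact: dnorm_ge0.
Qed.

Lemma cvg_ipl (u : nat -> H) (l y : H) : u @ \oo --> l ->
  (fun n => ip (u n) y : K[i]^o) @ \oo --> (ip l y : K[i]^o).
Proof.
move=> /cvgrPdist_lt ul; apply/cvgrPdist_lt => e e0.
have d0 : 0 < `|y| + 1 by rewrite ltr_wpDl.
near=> n; rewrite -ipBl; apply: le_lt_trans (cauchy_schwarz _ _) _.
apply: (@le_lt_trans _ _ (`|l - u n| * (`|y| + 1))).
  by rewrite ler_wpM2l // lerDl ler01.
rewrite -ltr_pdivlMr //; near: n; apply: ul; exact: divr_gt0.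
Unshelve. all: by end_near. Qed.

Lemma cvg_ipr (u : nat -> H) (l y : H) : u @ \oo --> l ->
  (fun n => ip y (u n) : K[i]^o) @ \oo --> (ip y l : K[i]^o).
Proof.
move=> /cvgrPdist_lt ul; apply/cvgrPdist_lt => e e0.
have d0 : 0 < `|y| + 1 by rewrite ltr_wpDl.
near=> n; rewrite -ipBr; apply: le_lt_trans (cauchy_schwarz _ _) _.
apply: (@le_lt_trans _ _ ((`|y| + 1) * `|l - u n|)).
  by rewrite ler_wpM2r // lerDl ler01.
rewrite mulrC -ltr_pdivlMr //; near: n; apply: ul; exact: divr_gt0.
Unshelve. all: by end_near. Qed.

Lemma parallelogram x y :
  ip (x - y) (x - y) + ip (x + y) (x + y) = 2 * ip x x + 2 * ip y y.
Proof. by rewrite !(ipBl, ipBr, ipDl, ipDr); ring. Qed.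

(* The best approximations [u n] of [w] in [L] form a Cauchy sequence by the
   parallelogram law; [L] need not be closed. *)
Lemma orthogonal_approximation (L : set H) (w : H) :
  L 0 -> (forall (a : K[i]) x y, L x -> L y -> L (a *: x + y)) ->
  exists u : nat -> H, exists m : H,
    [/\ forall n, L (u n), u @ \oo --> m & forall l, L l -> ip (w - m) l = 0].
Proof.
move=> L0 LP.
have LD x y : L x -> L y -> L (x + y) by move=> Lx Ly; rewrite -[x]scale1r; exact: LP.
have LZ a x : L x -> L (a *: x) by move=> Lx; rewrite -[_ *: x]addr0; exact: LP.
pose E := [set t : K | exists2 l, L l & t%:C = ip (w - l) (w - l)].
have lbE : lbound E 0 by move=> t [l Ll /esym tE]; rewrite -ler0c -tE dnorm_ge0.
have infE : has_inf E.
  split; last by exists 0.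
  have [r r0 rE] := ge0_complex (dnorm_ge0 ip (w - 0)).
  by exists r; exists 0.
have geE l : L l -> (inf E)%:C <= ip (w - l) (w - l).
  move=> Ll; have [r r0 rE] := ge0_complex (dnorm_ge0 ip (w - l)).
  by rewrite rE lecR; apply: ge_inf; [exists 0 | exists l].
have exE n : exists l, L l /\ ip (w - l) (w - l) < (inf E + n.+1%:R^-1)%:C.
  have [|t [l Ll tE] tlt] := @inf_adherent _ E (n.+1%:R^-1) _ infE.
    by rewrite invr_gt0.
  by exists l; split => //; rewrite -tE ltcR.
have [u uE] := choice exE.
have Lu n : L (u n) by case: (uE n).
(* The midpoint of [u n] and [u k] lies in [L], so its squared distance to [w] is at least [inf E];
   the parallelogram law turns this into a bound on [u n - u k]. *)
have uB n k : ip (u n - u k) (u n - u k) <=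
    (2 * n.+1%:R^-1 + 2 * k.+1%:R^-1)%:C.
  have := parallelogram (w - u k) (w - u n).
  have -> : w - u k - (w - u n) = u n - u k by rewrite opprB addrC addrA subrK.
  have -> : w - u k + (w - u n) = 2 *: (w - 2^-1 *: (u n + u k)).
    rewrite scalerBr scalerA divff ?pnatr_eq0 // scale1r.
    by rewrite scaler_nat mulr2n addrACA -opprD [u k + _]addrC.
  rewrite ipZl ipZr => /(congr1 (fun z => z - 2 * (2^*%R *
    ip (w - 2^-1 *: (u n + u k)) (w - 2^-1 *: (u n + u k))))).
  rewrite addrK => ->; rewrite rmorph_nat mulrA.
  have := geE _ (LZ 2^-1 _ (LD _ _ (Lu n) (Lu k))).
  set d := ip (w - 2^-1 *: _) _ => dge.
  have [_ /ltW an] := uE n; have [_ /ltW ak] := uE k.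
  apply: (@le_trans _ _ (2 * (inf E + k.+1%:R^-1)%:C +
     2 * (inf E + n.+1%:R^-1)%:C - 2 * 2 * (inf E)%:C)).
    by rewrite lerB ?lerD ?ler_pM2l ?mulr_gt0 ?ltr0n.
  have -> : (2 : K[i]) = (2 : K)%:C by rewrite rmorph_nat.
  rewrite -!(rmorphM (real_complex K)) -!rmorphD -rmorphB lecR.
  move: (inf E) (_^-1) (_^-1) => i0 a b; lra.
have [m um] : exists m : H, u @ \oo --> m.
  apply: complete_seq => e e0.
  have [|N _ Nh] := near_lt_harmonic (_ : 0 < e ^+ 2 / 4).
    by rewrite divr_gt0 ?exprn_gt0.
  exists N => n k /Nh /= hn /Nh /= hk.
  rewrite -(@ltr_pXn2r _ 2) ?nnegrE ?ler0c ?(ltW e0) // hH.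
  apply: le_lt_trans (uB _ _) _; rewrite -(rmorphXn (real_complex K)) ltcR.
  by move: (e ^+ 2) (n.+1%:R^-1) (k.+1%:R^-1) hn hk => e2 a b hn hk; lra.
exists u; exists m; split => // l Ll.
have [->|l0] := eqVneq l 0; first exact: ip0r.
have d0 : 0 < ip l l by rewrite dnorm_gt0.
have [r r0 rE] := gt0_complex d0.
(* Correcting [u n] along [l] stays in [L], hence cannot bring the squared distance below [inf E].
   The gain, [|ip (w - u n) l| ^+ 2 / r], is thus at most the excess of [u n] over [inf E]. *)
have small n : `|ip (w - u n) l| ^+ 2 <= (n.+1%:R^-1 * r)%:C.
  rewrite rmorphM /= -rE -ler_pdivrMr //.
  have := geE _ (LP (ip (w - u n) l / ip l l) _ _ Ll (Lu n)).
  rewrite opprD addrCA addrC sqr_norm_sub_proj //.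
  have [_ /ltW an] := uE n => h; have := le_trans h (lerB an (lexx _)).
  by rewrite rmorphD /= -addrA lerDl subr_ge0.
have c1 : (fun n => ip (w - u n) l : K[i]^o) @ \oo --> (ip (w - m) l : K[i]^o).
  by apply: cvg_ipl; apply: cvgB => //; exact: cvg_cst.
have c2 : (fun n => ip (w - u n) l : K[i]^o) @ \oo --> (0 : K[i]^o).
  apply/cvgrPdist_lt => _ /gt0_complex[e e0 ->].
  have e2 : 0 < e ^+ 2 / r by rewrite divr_gt0 ?exprn_gt0.
  apply: filterS (near_lt_harmonic e2) => n hn; rewrite sub0r normrN.
  rewrite -(@ltr_pXn2r _ 2) ?nnegrE ?normr_ge0 ?ler0c ?(ltW e0) //.
  apply: le_lt_trans (small n) _.
  by rewrite -rmorphXn ltcR -ltr_pdivlMr.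
exact: (cvg_unique (@norm_hausdorff _ _) c1 c2).
Qed.

End InnerProduct.

(** * Bounded operators and two-dimensional spaces *)

Section BoundedOperators.
Variables (K : realType) (H : completeNormedModType K[i]).
Implicit Types (T U : H -> H) (x y : H).

Lemma linear_add T x y : linear T -> T (x + y) = T x + T y.
Proof. by move=> l; rewrite -[x in LHS]scale1r l scale1r. Qed.

Lemma linear_zero T : linear T -> T 0 = 0.
Proof. by move=> l; apply: (addrI (T 0)); rewrite -linear_add // !addr0. Qed.

Lemma linear_scale T a x : linear T -> T (a *: x) = a *: T x.
Proof. by move=> l; rewrite -[_ *: x in LHS]addr0 l linear_zero // addr0. Qed.

Lemma linear_opp T x : linear T -> T (- x) = - T x.
Proof. by move=> l; rewrite -scaleN1r linear_scale // scaleN1r. Qed.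

Lemma bounded_opP T : bounded_op T ->
  exists2 M : K, 0 < M & forall x, `|T x| <= M%:C * `|x|.
Proof.
move=> [_ [M hM]]; exists (`|M| + 1); first by rewrite ltr_wpDl.
move=> x; apply: le_trans (hM x) _; apply: ler_wpM2r => //.
by rewrite lecR (le_trans (ler_norm M)) // lerDl.
Qed.

Lemma bounded_id : bounded_op (@id H).
Proof. by split; [move=> a x y | exists 1 => x; rewrite mul1r]. Qed.

Lemma bounded_comp T U : bounded_op T -> bounded_op U -> bounded_op (T \o U).
Proof.
move=> bT bU; have [M M0 hM] := bounded_opP bT; have [N N0 hN] := bounded_opP bU.
case: bT bU => lT _ [lU _]; split=> [a x y /=|]; first by rewrite lU lT.
exists (M * N) => x /=; apply: le_trans (hM _) _.
by rewrite rmorphM -mulrA ler_wpM2l // ler0c ltW.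
Qed.

Lemma bounded_add T U : bounded_op T -> bounded_op U ->
  bounded_op (fun x => T x + U x).
Proof.
move=> [lT [M hM]] [lU [N hN]]; split=> [a x y|].
  by rewrite lU lT scalerDr addrACA.
exists (M + N) => x; apply: le_trans (ler_normD _ _) _.
by rewrite rmorphD mulrDl lerD.
Qed.

Lemma bounded_scale (a : K[i]) T : bounded_op T ->
  bounded_op (fun x => a *: T x).
Proof.
move=> [lT [M hM]]; split=> [b x y|].
  by rewrite lT scalerDr !scalerA mulrC.
have [r r0 rE] := ge0_complex (normr_ge0 a).
by exists (r * M) => x; rewrite normrZ rE rmorphM -mulrA ler_wpM2l ?ler0c.
Qed.

Lemma bounded_opp T : bounded_op T -> bounded_op (fun x => - T x).
Proof.
by move/(bounded_scale (-1)); congr bounded_op; apply/funext => x; rewrite scaleN1r.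
Qed.

(** If [T x] were nonzero, a point [y] of the span within [|T x| / M] of [x] would give
    [|T x| = |T (x - y)| < |T x|]. *)
Lemma bounded_vanish_closure T (X : set H) : bounded_op T ->
  (forall x, X x -> T x = 0) -> closure (lin_span X) = setT ->
  forall x, T x = 0.
Proof.
move=> bT TX clX x; have [M M0 hM] := bounded_opP bT; have lT := bT.1.
apply/eqP; rewrite -normr_eq0; apply/negP => /negP Tx0.
have Tx : 0 < `|T x| by rewrite lt_def Tx0 normr_ge0.
have M0' : 0 < M%:C :> K[i] by rewrite (ltcR 0).
have : closure (lin_span X) x by rewrite clX.
move=> /(_ _ (nbhsx_ballx x (`|T x| / M%:C) (divr_gt0 Tx M0')))[y [[n [c [v [Xv ->]]]]]].
have T0 : T (\sum_(i < n) c i *: v i) = 0.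
  elim/big_ind : _ => [|a b Ta Tb|i _]; first exact: linear_zero.
    by rewrite linear_add // Ta Tb addr0.
  by rewrite linear_scale // TX // scaler0.
rewrite -ball_normE /= ltr_pdivlMr // mulrC => /(le_lt_trans (hM _)).
by rewrite linear_add // linear_opp // T0 subr0 ltxx.
Qed.

(** In the coordinates of a basis, independence of [e] and [f] makes their determinant nonzero, and
    Cramer's rule gives the coefficients. *)
Lemma has_dim2_spanned (V : set H) (e f : H) : has_dim V 2 -> V e -> V f ->
  (forall a b : K[i], a *: e + b *: f = 0 -> a = 0 /\ b = 0) ->
  forall x, V x -> exists a b : K[i], x = a *: e + b *: f.
Proof.
move=> [b [-> _]] [p ->] [q ->] ind x [c ->].
rewrite !big_ord_recl !big_ord0 !addr0 in ind *.
set k := lift ord0 ord0 in ind *.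
move: (b ord0) (b k) (p ord0) (p k) (q ord0) (q k) (c ord0) (c k) ind
  => b0 b1 p0 p1 q0 q1 c0 c1 ind {x}.
have comb r s : r *: (p0 *: b0 + p1 *: b1) + s *: (q0 *: b0 + q1 *: b1) =
    (r * p0 + s * q0) *: b0 + (r * p1 + s * q1) *: b1.
  by rewrite !scalerDr !scalerDl !scalerA addrACA.
have det : p0 * q1 - p1 * q0 != 0.
  apply/negP => /eqP d0.
  (* With zero determinant, [q1 e - p1 f] and [q0 e - p0 f] vanish, so all four coordinates are zero
     and [e = 0], against independence. *)
  have [q10 /eqP] : q1 = 0 /\ - p1 = 0.
    apply: ind; rewrite comb mulrC mulNr d0 scale0r add0r.
    by rewrite mulNr mulrC subrr scale0r.
  rewrite oppr_eq0 => /eqP p10.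
  have [q00 /eqP] : q0 = 0 /\ - p0 = 0.
    apply: ind; rewrite comb p10 q10 !mulr0 addr0 scale0r addr0.
    by rewrite mulNr mulrC subrr scale0r.
  rewrite oppr_eq0 => /eqP p00.
  have [/eqP] : (1 : K[i]) = 0 /\ (0 : K[i]) = 0.
    by apply: ind; rewrite comb p00 p10 !(mulr0, mul0r, add0r, scale0r).
  by rewrite oner_eq0.
exists ((c0 * q1 - c1 * q0) / (p0 * q1 - p1 * q0)).
exists ((p0 * c1 - p1 * c0) / (p0 * q1 - p1 * q0)).
by rewrite comb; congr (_ *: _ + _ *: _); field.
Qed.

End BoundedOperators.

(** * Commutation and adjoints in terms of graphs *)

Section Graphs.
Variables (K : realType) (H : completeNormedModType K[i]).
Variable ip : {dot H for (@Num.conj K[i])}.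
Hypothesis hH : hilbert ip.
Implicit Types (A S : set (H * H)) (T : H -> H).

(** The half [T A] contained in [A T] of commutation. It passes to compositions, linear combinations
    and adjoints, and for an involution [T] it gives back full commutation. *)
Definition preserves A T := forall p, A p -> A (T p.1, T p.2).

Lemma commute_preserves A T : commute A T -> preserves A T.
Proof.
move=> cAT [x y] Axy /=.
have : op_comp (graph T) A (x, T y) by exists y.
by rewrite -cAT /op_comp /graph => -[z /= ->].
Qed.

Lemma preserves_commute A T : T \o T = id -> preserves A T -> commute A T.
Proof.
move=> TT pAT; have TK x : T (T x) = x by rewrite -[LHS]/((T \o T) x) TT.
rewrite /commute /op_comp /graph; apply/seteqP; split=> -[x y] [z /=].
  by move=> -> /pAT /=; rewrite TK => Axy; exists (T y); rewrite //= TK.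
by move=> /pAT /= A1 /= ->; exists (T x).
Qed.

Lemma preserves_comp A T U : preserves A T -> preserves A U -> preserves A (T \o U).
Proof. by move=> pT pU p /pU /pT. Qed.

Lemma preserves_comb A T U (a b : K[i]) : is_operator A ->
  preserves A T -> preserves A U -> preserves A (fun x => a *: T x + b *: U x).
Proof.
move=> [A0 AL _] pT pU p Ap; have := AL b _ _ (pU _ Ap) A0.
rewrite /= !addr0 => /(AL a _ _ (pT _ Ap)) //.
Qed.

Lemma adjoint_comb A (a : K[i]) p q : adjoint ip A p -> adjoint ip A q ->
  adjoint ip A (a *: p.1 + q.1, a *: p.2 + q.2).
Proof.
by move=> Ap Aq r Ar /=; rewrite !(ipDr, ipZr) (Ap _ Ar) (Aq _ Ar).
Qed.

Lemma ip_inj x y : (forall z, ip z x = ip z y) -> x = y.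
Proof.
by move=> xy; apply/eqP; rewrite -subr_eq0 -(dnorm_eq0 ip) ipBr xy subrr.
Qed.

Lemma selfadjoint_graphP T : adjoint ip (graph T) = graph T <->
  forall x y, ip (T x) y = ip x (T y).
Proof.
split=> [aT x y|sT].
  have : graph T (y, T y) by [].
  by rewrite -aT => /(_ (x, T x)); exact.
apply/seteqP; split=> -[x y] /=.
  by move=> h; apply: ip_inj => z; rewrite -sT -(h (z, T z)).
by rewrite /graph /= => -> [u v] /= ->; exact: sT.
Qed.

Lemma adjoint_preserves A T : adjoint ip (graph T) = graph T ->
  preserves A T -> preserves (adjoint ip A) T.
Proof.
move=> /selfadjoint_graphP sT pT q Aq p Ap /=.
by rewrite -!sT; exact: (Aq _ (pT _ Ap)).
Qed.

(** * Resolvents of self-adjoint operators and defect spaces *)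

Section SelfAdjoint.
Variable A : set (H * H).
Hypotheses (opA : is_operator A) (saA : adjoint ip A = A).
Variable nu : K[i].
Hypothesis nuNR : nu \isn't Num.real.

Lemma selfadjoint_symmetric p q : A p -> A q -> ip p.2 q.1 = ip p.1 q.2.
Proof. by move=> Ap; rewrite -saA => /(_ _ Ap). Qed.

Lemma nonreal_gap : 0 < `|nu - nu^*%R|.
Proof. by rewrite normr_gt0 subr_eq0 eq_sym -CrealE. Qed.

Lemma resolvent_bound x z : A (x, z) ->
  `|nu - nu^*%R| * `|x| <= 2 * `|z - nu *: x|.
Proof.
move=> Axz; have [->|x0] := eqVneq x 0; first by rewrite normr0 mulr0 mulr_ge0.
have nx : 0 < `|x| by rewrite normr_gt0.
rewrite -(ler_pM2r nx) -!mulrA -expr2 hH -[X in _ * X]ger0_norm ?dnorm_ge0 //.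
rewrite -normrM.
have -> : (nu - nu^*%R) * ip x x = ip x (z - nu *: x) - ip (z - nu *: x) x.
  by rewrite ipBr ipBl ipZr ipZl (selfadjoint_symmetric Axz Axz) /=; ring.
apply: le_trans (ler_normB _ _) _; rewrite mulr_natl mulr2n lerD //.
  by rewrite mulrC cauchy_schwarz.
exact: cauchy_schwarz.
Qed.

Lemma eigenvector_zero x : A (x, nu *: x) -> x = 0.
Proof.
move=> /resolvent_bound; rewrite subrr normr0 mulr0 pmulr_rle0 ?nonreal_gap //.
by rewrite normr_le0 => /eqP.
Qed.

(** The range of [A - nu] is dense because its orthogonal complement lies in the kernel of
    [A - nu^*], which is zero. [resolvent_bound] makes preimages of a convergent sequence Cauchy,
    and the graph of an adjoint is closed. *)
Lemma resolvent_surjective w : exists x, A (x, w + nu *: x).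
Proof.
have [A0 AL _] := opA.
pose L := [set l | exists2 p, A p & l = p.2 - nu *: p.1].
have [||u [m [Lu um mL]]] := @orthogonal_approximation _ _ ip hH L w.
- by exists (0, 0) => //=; rewrite scaler0 subr0.
- move=> a _ _ [p Ap ->] [q Aq ->].
  exists (a *: p.1 + q.1, a *: p.2 + q.2); first exact: AL.
  by rewrite /= scalerBr scalerDr !scalerA [nu * a]mulrC opprD addrACA.
have /choice[p pE] n : exists q, A q /\ u n = q.2 - nu *: q.1.
  by have [q Aq ->] := Lu n; exists q.
have wm : w - m = 0.
  apply: eigenvector_zero.
  have A' : A (w - m, nu^*%R *: (w - m)).
    rewrite -saA => q Aq /=; rewrite ipZr conjCK.
    apply/eqP; rewrite -subr_eq0 -ipZl -ipBl ipC.
    by rewrite mL ?conjC0 //; exists q.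
  have := selfadjoint_symmetric A' A'; rewrite /= ipZl ipZr conjCK => /eqP.
  rewrite -subr_eq0 -mulrBl mulf_eq0 subr_eq0 -CrealE (negPf nuNR) /=.
  by rewrite dnorm_eq0 => /eqP wm0; rewrite wm0 scaler0.
have [x px] : exists x : H, (fun n => (p n).1) @ \oo --> x.
  apply: complete_seq => e e0.
  have [g g0 gE] := gt0_complex nonreal_gap.
  have /cvgrPdist_lt ul := um.
  (* Here [g] is the gap [|nu - nu^*|]: the preimages satisfy [g |p n - p k| <= 2 |u n - u k| < 2 (g
     e / 4 + g e / 4) = g e]. *)
  have [|N _ Nh] := ul ((g * e / 4)%:C).
    by rewrite ltcR divr_gt0 ?mulr_gt0.
  exists N => n k Nn Nk.
  have Apk : A ((p n).1 - (p k).1, (p n).2 - (p k).2).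
    have := AL (-1) _ _ (pE k).1 (pE n).1.
    by rewrite !scaleN1r ![- _ + _]addrC.
  have := resolvent_bound Apk; rewrite gE.
  have -> : (p n).2 - (p k).2 - nu *: ((p n).1 - (p k).1) = u n - u k.
    by rewrite (pE n).2 (pE k).2 scalerBr !opprD !opprK addrACA.
  have -> : u n - u k = (m - u k) - (m - u n).
    by rewrite opprB [RHS]addrC addrA subrK.
  have gC : 0 < g%:C :> K[i] by rewrite (ltcR 0).
  rewrite -(ltr_pM2l gC) => h; apply: le_lt_trans h _.
  apply: (@le_lt_trans _ _ (2 * (`|m - u k| + `|m - u n|))).
    by rewrite ler_wpM2l ?ler0n // ler_normB.
  have -> : g%:C * e%:C = 2 * ((g * e / 4)%:C + (g * e / 4)%:C) :> K[i].
    have -> : (2 : K[i]) = (2 : K)%:C by rewrite rmorph_nat.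
    by rewrite -rmorphD -!(rmorphM (real_complex K)); congr (_%:C); field.
  by rewrite ltr_pM2l ?ltr0n // ltrD //; [exact: (Nh _ Nk) | exact: (Nh _ Nn)].
have wm' : m = w by apply/eqP; rewrite eq_sym -subr_eq0 wm.
have pz : (fun n => (p n).2) @ \oo --> w + nu *: x.
  rewrite -wm'.
  have -> : (fun n => (p n).2) = (fun n => u n + nu *: (p n).1).
    by apply/funext => n; rewrite (pE n).2 subrK.
  by apply: cvgD => //; exact: cvgZr.
(* Closedness of the graph: the symmetry relation between [q] and the points [p n] passes to the
   limit. *)
exists x; rewrite -saA => q Aq /=.
have c1 := cvg_ipr (y := q.2) hH px; have c2 := cvg_ipr (y := q.1) hH pz.
have cE : (fun n => ip q.2 (p n).1) = (fun n => ip q.1 (p n).2).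
  by apply/funext => n; rewrite (selfadjoint_symmetric Aq (pE n).1).
rewrite cE in c1.
exact: (cvg_unique (@norm_hausdorff _ _) c1 c2).
Qed.

(* The map [x |-> x + (nu - mu) (A - nu)^-1 x] from the defect space at [mu]
   to the one at [nu]. *)
Lemma defect_transfer S (mu : K[i]) (x : H) : S `<=` A -> mu \isn't Num.real ->
  eigen_ker (adjoint ip S) mu x ->
  exists y, [/\ eigen_ker (adjoint ip S) nu y, y = 0 -> x = 0 &
    forall T, linear T -> preserves A T -> T x = 0 -> T y = 0].
Proof.
move=> SA muNR Nx; have [A0 AL _] := opA.
have [r Ar] := resolvent_surjective x.
exists ((nu - mu) *: r + x); split.
(* [S <= A] and [A^* = A] place the graph of [A] inside that of [S^*]. *)
- have Sr : adjoint ip S (r, x + nu *: r).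
    by move=> p /SA Ap; move: Ar; rewrite -saA => /(_ _ Ap).
  have := adjoint_comb (nu - mu) Sr Nx; rewrite /= /eigen_ker /=.
  congr (adjoint ip S (_, _)).
  by rewrite !scalerDr -addrAC -scalerDl subrK !scalerA [nu * _]mulrC addrC.
(* If the image vanishes then [x = (mu - nu) r], so [r] is an eigenvector of [A] at the non-real
   [mu], hence zero. *)
- have [->|nm] := eqVneq nu mu; first by rewrite subrr scale0r add0r.
  move=> /eqP; rewrite addrC addr_eq0 => /eqP xE; rewrite xE.
  suff -> : r = 0 by rewrite scaler0 oppr0.
  have : A (r, mu *: r).
    by move: Ar; rewrite xE -scaleNr -scalerDl opprB subrK.
  have gap : 0 < `|mu - mu^*%R| by rewrite normr_gt0 subr_eq0 eq_sym -CrealE.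
  move=> Amu; have := selfadjoint_symmetric Amu Amu.
  rewrite /= ipZl ipZr => /eqP; rewrite -subr_eq0 -mulrBl mulf_eq0.
  by rewrite -normr_eq0 gt_eqF //= dnorm_eq0 => /eqP.
(* As [T] kills [x], applying it to the resolvent equation makes [T r] an eigenvector of [A] at
   [nu], hence zero. *)
- move=> T lT pT Tx; have := pT _ Ar; rewrite /= linear_add // linear_scale //.
  rewrite Tx add0r => /eigenvector_zero Tr.
  by rewrite linear_add // linear_scale // Tr Tx scaler0 addr0.
Qed.

End SelfAdjoint.
End Graphs.

(** * The algebra of [J] and [R] *)

Section AnticommutingSymmetries.
Variables (K : realType) (H : completeNormedModType K[i]).
Variable ip : {dot H for (@Num.conj K[i])}.
Variables (J R : H -> H) (S : set (H * H)).
Hypotheses (hJ : fundamental_symmetry ip J) (hR : fundamental_symmetry ip R).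
Hypothesis hJR : anticommute J R.
Hypotheses (opS : is_operator S) (SJ : preserves S J) (SR : preserves S R).

(** Testing against an arbitrary [z] turns vector identities into scalar ones that [ring] and
    [field] decide. *)
Lemma ip_injl x y : (forall z, ip x z = ip y z) -> x = y.
Proof. by move=> xy; apply: (ip_inj (ip := ip)) => z; rewrite ipC xy -ipC. Qed.

Lemma fundamental_symmetryE T : fundamental_symmetry ip T ->
  [/\ linear T, forall x, T (T x) = x & forall x y, ip (T x) y = ip x (T y)].
Proof.
by move=> [[lT _] /selfadjoint_graphP sT TT]; split=> // x; rewrite -[LHS]/((T \o T) x) TT.
Qed.

Let linJ : linear J. Proof. by have [] := fundamental_symmetryE hJ. Qed.
Let linR : linear R. Proof. by have [] := fundamental_symmetryE hR. Qed.
Let JK x : J (J x) = x. Proof. by have [_ + _] := fundamental_symmetryE hJ; apply. Qed.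
Let RK x : R (R x) = x. Proof. by have [_ + _] := fundamental_symmetryE hR; apply. Qed.
Let saJ x y : ip (J x) y = ip x (J y).
Proof. by have [_ _] := fundamental_symmetryE hJ; apply. Qed.
Let saR x y : ip (R x) y = ip x (R y).
Proof. by have [_ _] := fundamental_symmetryE hR; apply. Qed.
Let JR x : J (R x) = - R (J x).
Proof. by apply/eqP; rewrite -addr_eq0 hJR. Qed.

Let linJR := ((fun x y => linear_add x y linJ), (fun x y => linear_add x y linR),
  (fun a x => linear_scale a x linJ), (fun a x => linear_scale a x linR),
  (fun x => linear_opp x linJ), (fun x => linear_opp x linR)).

(** With [J] and [R] read as the Pauli matrices sigma_z and sigma_x, [i R J] is sigma_y; this is the
    shape that [J C] takes for a C-symmetry [C]. *)
Definition pauli_comb (a c d : K) (x : H) : H :=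
  a%:C *: x + c%:C *: R x + ('i * d%:C) *: R (J x).

Lemma bounded_pauli_comb a c d : bounded_op (pauli_comb a c d).
Proof.
have [bJ _ _] := hJ; have [bR _ _] := hR.
apply: bounded_add; last exact: bounded_scale (bounded_comp bR bJ).
by apply: bounded_add; apply: bounded_scale => //; exact: bounded_id.
Qed.

Lemma preserves_pauli_comb A a c d : is_operator A ->
  preserves A J -> preserves A R -> preserves A (pauli_comb a c d).
Proof.
move=> opA AJ AR.
have A1 : preserves A (fun x => a%:C *: x + c%:C *: R x).
  by apply: preserves_comb => // -[].
have := preserves_comb 1 ('i * d%:C) opA A1 (preserves_comp AR AJ).
by congr preserves; apply/funext => x; rewrite scale1r.
Qed.

Lemma selfadjoint_pauli_comb a c d x y :
  ip (pauli_comb a c d x) y = ip x (pauli_comb a c d y).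
Proof.
rewrite !(ipDl, ipDr, ipZl, ipZr) !saR saJ JR linearN /= rmorphM /=.
have rC : forall r : K, (r%:C)^*%R = r%:C :> K[i] by move=> r; exact: conjc_real.
have -> : ('i : K[i])^*%R = - 'i by rewrite -complexiE conjCi.
by rewrite !rC; ring.
Qed.

Lemma pauli_combJ a c d x :
  J (pauli_comb a c d x) = pauli_comb a (- c) (- d) (J x).
Proof.
rewrite /pauli_comb !linJR !JR JK.
by apply: ip_injl => z; rewrite !(ipDl, ipZl, ipNl, rmorphN) /=; ring.
Qed.

Lemma sqri : 'i * 'i = -1 :> K[i]. Proof. by rewrite -expr2 sqr_i. Qed.

(** [R] and [i R J] anticommute and square to the identity, so [N = c R + d i R J] satisfies
    [N^2 = c^2 + d^2], and the product is [(a + N) (a - N)]. *)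
Lemma pauli_comb_mul a c d x :
  pauli_comb a c d (pauli_comb a (- c) (- d) x) = (a ^+ 2 - c ^+ 2 - d ^+ 2)%:C *: x.
Proof.
rewrite {1}/pauli_comb pauli_combJ !opprK /pauli_comb.
rewrite !linJR ?JK ?RK.
apply: ip_injl => z; rewrite !(ipDl, ipZl, ipNl) /=.
have i2 := sqri.
rewrite !(rmorphB, rmorphXn, rmorphN) /=.
rewrite [RHS](_ : _ = (a%:C ^+ 2 - c%:C ^+ 2 + 'i * 'i * d%:C ^+ 2) * ip x z).
  by ring.
by rewrite i2; ring.
Qed.

(** The condition on [a] makes [a - N] the inverse of [F = a + N]. Since [J F = (a - N) J], the
    operator [J F] squares to the identity. *)
Lemma pauli_comb_C_symmetry a c d : 0 < a -> a ^+ 2 = 1 + c ^+ 2 + d ^+ 2 ->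
  C_symmetries ip J S (J \o pauli_comb a c d).
Proof.
move=> a0 aE; pose F := pauli_comb a c d.
have aE1 : a ^+ 2 - c ^+ 2 - d ^+ 2 = 1 by rewrite aE; ring.
have mul1 x : F (pauli_comb a (- c) (- d) x) = x.
  by rewrite /F pauli_comb_mul aE1 rmorph1 scale1r.
have CC : (J \o F) \o (J \o F) = id.
  apply/funext => x /=; rewrite pauli_combJ JK.
  have := pauli_comb_mul a (- c) (- d) x.
  by rewrite !opprK !sqrrN aE1 rmorph1 scale1r.
have JJF x : J (J (F x)) = F x by rewrite JK.
have [bJ _ _] := hJ; split.
- exact: bounded_comp (bounded_pauli_comb _ _ _).
- exact: CC.
- split=> [|x x0].
    by apply/selfadjoint_graphP => x y /=; rewrite !JJF selfadjoint_pauli_comb.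
  rewrite /= JJF.
  have Fm : pauli_comb a (- c) (- d) x = (2 * a%:C) *: x - F x.
    rewrite /F /pauli_comb; apply: ip_injl => z.
    by rewrite !(ipBl, ipDl, ipZl) /=; ring.
  have := mul1 x; have lF : linear F := (bounded_pauli_comb a c d).1.
  rewrite Fm (linear_add _ _ lF) (linear_opp _ lF) (linear_scale _ _ lF) => FF.
  (* Positivity: applying [F] to [F + F^-1 = 2 a] gives [2 a F = 1 + F^2], with [F] symmetric. *)
  have : 0 < 2 * a%:C * ip (F x) x.
    have -> : 2 * a%:C * ip (F x) x = ip x x + ip (F x) (F x).
      rewrite -[ip (F x) (F x)]selfadjoint_pauli_comb -ipDl -ipZl.
      by congr (ip _ x); apply/eqP; rewrite -subr_eq FF.
    by rewrite ltr_wpDr ?dnorm_ge0 // dnorm_gt0.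
  by rewrite pmulr_rgt0 // mulr_gt0 ?ltr0n // (ltcR 0).
- apply: preserves_commute => //; apply: preserves_comp => //.
  exact: preserves_pauli_comb.
Qed.

(** Two particular C-symmetries, [J] itself and one involving [R], suffice: commuting with both
    gives invariance under [J] and [R], and then [A^* J = J A = A J] yields [A^* = A]. *)
Lemma Upsilon_selfadjoint A : Upsilon ip J S A ->
  [/\ is_operator A, adjoint ip A = A, S `<=` A, preserves A J & preserves A R].
Proof.
move=> [[[opA _ AJ] SA] AC].
have pJ : preserves A J.
  have /AC/commute_preserves : C_symmetries ip J S (J \o pauli_comb 1 0 0).
    by apply: pauli_comb_C_symmetry => //; rewrite expr0n /= !addr0 expr1n.
  congr preserves; apply/funext => x /=.
  by rewrite /pauli_comb mulr0 !scale0r !addr0 scale1r.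
have pR : preserves A R.
  (* A rational point of [a^2 = 1 + c^2]; [R] is recovered as [4/3 (5/4 + 3/4 R) - 5/3]. *)
  have /AC/commute_preserves : C_symmetries ip J S (J \o pauli_comb (5 / 4) (3 / 4) 0).
    by apply: pauli_comb_C_symmetry => //; lra.
  move=> /(preserves_comp pJ) pC.
  have : preserves A (fun x =>
      4 / 3 *: (J \o (J \o pauli_comb (5 / 4) (3 / 4) 0)) x + - (5 / 3) *: x).
    by apply: preserves_comb => // -[].
  congr preserves; apply/funext => x /=.
  rewrite JK /pauli_comb mulr0 scale0r addr0; apply: ip_injl => z.
  by rewrite !(ipDl, ipZl) !fmorph_div !rmorph_nat; field.
split=> //; apply/seteqP; split=> -[x y] Axy.
- have : op_comp (adjoint ip A) (graph J) (J x, y).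
    by exists x => //=; rewrite /graph /= JK.
  rewrite AJ => -[z Az]; rewrite /graph /= => ->.
  by have := pJ _ Az; rewrite /= JK.
- have : op_comp (graph J) A (J x, y).
    by exists (J y); [exact: (pJ _ Axy) | rewrite /graph /= JK].
  by rewrite -AJ /op_comp /graph => -[z /= ->]; rewrite JK.
Qed.

(** * C-symmetries on the defect spaces *)

Hypothesis hH : hilbert ip.
Hypotheses (Ss : simple_op ip S) (Sdef : defect_numbers_2_2 ip S).

(** For a nonzero defect vector [b], the vector [b + J b] is fixed by [J]. If it is zero then
    [J b = - b], and anticommutation makes [R b] fixed. *)
Lemma fixed_defect_vector mu : mu \isn't Num.real ->
  exists e, [/\ eigen_ker (adjoint ip S) mu e, e != 0 & J e = e].
Proof.
have adjJ : preserves (adjoint ip S) J by apply: adjoint_preserves => //; case: hJ.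
have adjR : preserves (adjoint ip S) R by apply: adjoint_preserves => //; case: hR.
move=> muNR; have [b [VE ind]] := Sdef muNR.
have Vb : eigen_ker (adjoint ip S) mu (b ord0).
  rewrite VE; exists (fun i => (i == ord0)%:R).
  by rewrite !big_ord_recl big_ord0 /= scale1r scale0r !addr0.
have b0 : b ord0 != 0.
  apply/negP => /eqP b0; have := ind (fun i => (i == ord0)%:R).
  rewrite !big_ord_recl big_ord0 /= scale1r scale0r !addr0 => /(_ b0 ord0) /eqP.
  by rewrite eqxx oner_eq0.
have VT T x : linear T -> preserves (adjoint ip S) T ->
    eigen_ker (adjoint ip S) mu x -> eigen_ker (adjoint ip S) mu (T x).
  by move=> lT pT Vx; have := pT _ Vx; rewrite /= linear_scale.
have [s0|s0] := eqVneq (b ord0 + J (b ord0)) 0.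
  have Jb : J (b ord0) = - b ord0 by apply/eqP; rewrite -addr_eq0 addrC s0.
  exists (R (b ord0)); split; first exact: VT.
  - by apply: contra b0 => /eqP Rb; rewrite -[b _]RK Rb linear_zero.
  - by rewrite JR Jb linJR opprK.
exists (b ord0 + J (b ord0)); split => //.
- have := adjoint_comb 1 Vb (VT _ _ linJ adjJ Vb).
  by rewrite /eigen_ker /= !scale1r scalerDr.
- by rewrite linJR JK addrC.
Qed.

Lemma eigen_independent e f : J e = e -> J f = - f -> e != 0 -> f != 0 ->
  forall a b : K[i], a *: e + b *: f = 0 -> a = 0 /\ b = 0.
Proof.
move=> Je Jf e0 f0 a b ab0.
have : J (a *: e + b *: f) = 0 by rewrite ab0 linear_zero.
rewrite !linJR Je Jf scalerN => ab1.
have aE : a *: e = b *: f by apply/eqP; rewrite -subr_eq0 ab1.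
have bf : b *: f = 0.
  apply/eqP; move: ab0; rewrite aE -mulr2n => /eqP.
  by rewrite -scaler_nat scaler_eq0 pnatr_eq0.
split; apply/eqP; [move: aE; rewrite bf|move: bf] => /eqP;
  by rewrite scaler_eq0 ?(negPf e0) ?(negPf f0) orbF.
Qed.

(** In the orthogonal pair [e], [R e] of equal norms, [J] is diag(1, -1) and [F = J C] is a positive
    Hermitian 2x2 matrix with [F J F = J]. Comparing entries determines its form. *)
Lemma C_symmetry_on_pair C e : C_symmetries ip J S C -> e != 0 -> J e = e ->
  (exists a b, J (C e) = a *: e + b *: R e) ->
  (exists a b, J (C (R e)) = a *: e + b *: R e) ->
  exists a c d : K, [/\ 0 < a, a ^+ 2 = 1 + c ^+ 2 + d ^+ 2,
    J (C e) = pauli_comb a c d e & J (C (R e)) = pauli_comb a c d (R e)].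
Proof.
move=> [bC CC [/selfadjoint_graphP sF pF] _] e0 Je [al [be Fe]] [ga [de Ff]].
have CK x : C (C x) = x by rewrite -[LHS]/((C \o C) x) CC.
have linC := bC.1.
pose F x := J (C x).
have lF : linear F by move=> a x y; rewrite /F linC linJ.
have FJF x : F (J (F x)) = J x by rewrite /F JK CK.
set f := R e in Fe Ff *; have Jf : J f = - f by rewrite /f JR Je.
have f0 : f != 0 by apply: contra e0 => /eqP fz; rewrite -[e]RK -/f fz linear_zero.
have ind := eigen_independent Je Jf e0 f0.
have n0 : 0 < ip e e by rewrite dnorm_gt0.
have ff : ip f f = ip e e by rewrite /f saR RK.
have ef : ip e f = 0.
  have /eqP : ip e f = - ip e f by rewrite -{1}Je saJ Jf linearN.
  by rewrite -addr_eq0 -mulr2n mulrn_eq0 /= => /eqP.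
have fe : ip f e = 0 by rewrite ipC ef conjC0.
have [a a0 aE] : exists2 a : K, 0 < a & al = a%:C.
  apply: gt0_complex; have := pF _ e0.
  by rewrite /= Fe ipDl !ipZl fe mulr0 addr0 pmulr_lgt0.
have [d d0 dE] : exists2 d : K, 0 < d & de = d%:C.
  apply: gt0_complex; have := pF _ f0.
  by rewrite /= Ff ipDl !ipZl ef mulr0 add0r ff pmulr_lgt0.
have gaE : ga = be^*%R.
  have := sF e f; rewrite /= Fe Ff ipDl ipDr !(ipZl, ipZr) ef ff !mulr0 add0r addr0.
  by move=> /(mulIf (lt0r_neq0 n0)) ->; rewrite conjCK.
have [e1 e2] : al * al - be * ga - 1 = 0 /\ al * be - be * de = 0.
  apply: ind; have := FJF e; rewrite /F Fe !linJR Je Jf -/(F _).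
  rewrite (linear_add _ _ lF) !(linear_scale _ _ lF) (linear_opp _ lF).
  rewrite /F Fe Ff -/f => /eqP; rewrite -subr_eq0 => /eqP <-.
  apply: ip_injl => z; rewrite !(ipDl, ipBl, ipZl, ipNl) /=; ring.
have [e3 e4] : ga * al - de * ga = 0 /\ ga * be - de * de + 1 = 0.
  apply: ind; have := FJF f; rewrite /F Ff !linJR Je Jf -/(F _).
  rewrite (linear_add _ _ lF) !(linear_scale _ _ lF) (linear_opp _ lF).
  rewrite /F Fe Ff -/f => /eqP; rewrite -subr_eq0 => /eqP <-.
  by apply: ip_injl => z; rewrite !(ipDl, ipBl, ipZl, ipNl) /=; ring.
(* Adding the two diagonal equations cancels the off-diagonal product and leaves [a^2 = d^2], with
   both entries positive. *)
have ad : a = d.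
  have : a%:C * a%:C - d%:C * d%:C = 0 :> K[i].
    rewrite -aE -dE -[RHS](addr0 0) -{1}e1 -e4; ring.
  rewrite -!(rmorphM (real_complex K)) -rmorphB => /(congr1 (@complex.Re K)) /= /eqP.
  rewrite -!expr2 subr_eq0 eqrXn2 ?ltW // => /eqP //.
have be2 : be * ga = (complex.Re be ^+ 2 + complex.Im be ^+ 2)%:C.
  by rewrite gaE -normCK add_Re2_Im2.
(* On [e], [R] and [i R J] give [R e] and [i R e], so the entry [be] splits into real and imaginary
   part. *)
exists a, (complex.Re be), (complex.Im be); split => //.
- move: e1; rewrite aE be2 -(rmorphM (real_complex K)) -(rmorph1 (real_complex K)) -!rmorphB.
  by move=> /(congr1 (@complex.Re K)) /=; lra.
- rewrite Fe /pauli_comb Je aE -addrA -scalerDl.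
  by congr (_ + _ *: _); exact: complexE.
- rewrite Ff /pauli_comb RK -/f Jf linJR -[R f]/(R (R e)) RK dE -ad gaE.
  rewrite addrC -addrA scalerN -scalerBl; congr (_ + _ *: _).
  by case: be {be2 Fe e1 e2 e3 e4 gaE} => x y; apply/eqP;
    rewrite eq_complex /= ; apply/andP; split; apply/eqP; ring.
Qed.

(** The coefficients are read off at the defect space of ['i]. The difference [G] between [J C] and
    the resulting combination is bounded and preserves [A], so its vanishing spreads to every defect
    space and, by simplicity, to [H]. *)
Lemma C_symmetryP C : Upsilon ip J S !=set0 -> C_symmetries ip J S C ->
  exists a c d : K, [/\ 0 < a, a ^+ 2 = 1 + c ^+ 2 + d ^+ 2 &
    C = J \o pauli_comb a c d].
Proof.
move=> [A UA] SC; have [opA saA SA pJ pR] := Upsilon_selfadjoint UA.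
have [bC CC [saF _] cSC] := SC; have linC := bC.1.
have pF : preserves A (J \o C).
  by apply: preserves_comp => //; apply: commute_preserves; apply: UA.2.
have adjF : preserves (adjoint ip S) (J \o C).
  by apply: adjoint_preserves => //; apply: preserves_comp => //; exact: commute_preserves.
have adjR : preserves (adjoint ip S) R by apply: adjoint_preserves => //; case: hR.
have [bJ _ _] := hJ; have bF := bounded_comp bJ bC; have lF := bF.1.
have VT T mu x : linear T -> preserves (adjoint ip S) T ->
    eigen_ker (adjoint ip S) mu x -> eigen_ker (adjoint ip S) mu (T x).
  by move=> lT pT Vx; have := pT _ Vx; rewrite /= linear_scale.
have R0 x : R x = 0 -> x = 0 by move=> Rx; rewrite -[x]RK Rx linear_zero.
have JRe x : J x = x -> J (R x) = - R x by move=> Jx; rewrite JR Jx.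
have iNR : ('i : K[i]) \isn't Num.real by rewrite complex_real oner_eq0.
have [e [Ve e0 Je]] := fixed_defect_vector iNR.
have VR := VT _ _ _ linR adjR Ve.
have Re0 : R e != 0 by apply: contra e0 => /eqP/R0 ->.
have span := has_dim2_spanned (Sdef iNR) Ve VR (eigen_independent Je (JRe _ Je) e0 Re0).
have [a [c [d [a0 aE Ge GRe]]]] := C_symmetry_on_pair SC e0 Je
  (span _ (VT _ _ _ lF adjF Ve)) (span _ (VT _ _ _ lF adjF VR)).
pose G x := J (C x) - pauli_comb a c d x.
have bG : bounded_op G.
  by apply: (bounded_add bF); apply: bounded_opp; exact: bounded_pauli_comb.
have lG := bG.1.
have pG : preserves A G.
  have := preserves_comb 1 (-1) opA pF (preserves_pauli_comb a c d opA pJ pR).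
  by congr preserves; apply/funext => x; rewrite scale1r scaleN1r.
have G0 : forall x, G x = 0.
  apply: (bounded_vanish_closure bG _ Ss) => x [mu /= muNR Vx].
  (* The transfer from ['i] to [mu] carries the relations [(J - 1) e = 0], [G e = 0] and
     [G (R e) = 0] over to [e'], and [e'], [R e'] span the defect space at [mu]. *)
  have [e' [Ve' e'0 Te']] := defect_transfer hH opA saA muNR SA iNR Ve.
  have e'N : e' != 0 by apply: contra e0 => /eqP/e'0 ->.
  have Je' : J e' = e'.
    apply/eqP; rewrite -subr_eq0; apply/eqP.
    apply: (Te' (fun x => J x - x)); last by rewrite Je subrr.
      by move=> b y z; rewrite linJ scalerBr opprD addrACA.
    have : preserves A (fun x => 1 *: J x + -1 *: x) by apply: preserves_comb => // -[].
    by congr preserves; apply/funext => y; rewrite scale1r scaleN1r.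
  have Ge' : G e' = 0 by apply: Te' => //; rewrite /G Ge subrr.
  have GRe' : G (R e') = 0.
    apply: (Te' (G \o R)); last by rewrite /= /G GRe subrr.
      by move=> b y z /=; rewrite linR lG.
    exact: preserves_comp.
  have Re'0 : R e' != 0 by apply: contra e'N => /eqP/R0 ->.
  have [p [q ->]] := has_dim2_spanned (Sdef muNR) Ve' (VT _ _ _ linR adjR Ve')
    (eigen_independent Je' (JRe _ Je') e'N Re'0) Vx.
  by rewrite (linear_add _ _ lG) !(linear_scale _ _ lG) Ge' GRe' !scaler0 addr0.
exists a, c, d; split => //; apply/funext => x /=.
by have /eqP := G0 x; rewrite subr_eq0 => /eqP <-; rewrite JK.
Qed.

End AnticommutingSymmetries.

(** * Exponential series of involutions *)

Section Exponential.
Variables (K : realType) (H : completeNormedModType K[i]).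

Definition exp_partial_sum (s : K[i]) (n : nat) : K[i]^o :=
  \sum_(0 <= k < n) (k`!%:R : K[i])^-1 * s ^+ k.

Lemma cvg_exp_real (t : K) :
  exp_partial_sum t%:C @ \oo --> ((expR t)%:C : K[i]^o).
Proof.
have -> : exp_partial_sum t%:C = (fun n => (series (exp_coeff t) n)%:C).
  apply/funext => n; rewrite /exp_partial_sum /series /= rmorph_sum /=.
  apply: eq_bigr => k _; rewrite /exp_coeff /= mulrC.
  by rewrite (rmorphM (real_complex K)) fmorphV rmorphXn /= rmorph_nat.
by apply: cvg_real_complex; rewrite /expR; exact: is_cvg_series_exp_coeff.
Qed.

(** Termwise Euler formula: [cos_coeff] vanishes at odd and [sin_coeff] at even indices, so the
    parity of [k] selects one summand. *)
Lemma exp_coeff_imaginary (t : K) (k : nat) :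
  (k`!%:R : K[i])^-1 * ('i * t%:C) ^+ k =
  (cos_coeff t k)%:C + 'i * (sin_coeff t k)%:C.
Proof.
have ik : 'i ^+ k = (-1) ^+ k./2 * (if odd k then 'i else 1)%R :> K[i].
  rewrite -{1}[k]odd_double_half exprD mulrC -mul2n exprM sqrCi.
  by case: (odd k).
have fk : (k`!%:R : K[i])^-1 = ((k`!%:R)^-1 : K)%:C by rewrite fmorphV rmorph_nat.
rewrite exprMn ik fk -(rmorphXn (real_complex K)).
have -> : (-1) ^+ k./2 = ((-1) ^+ k./2 : K)%:C by rewrite rmorphXn rmorphN1.
rewrite /cos_coeff /sin_coeff /=.
have [ok|ek] := boolP (odd k); rewrite /= !(mul0r, mul1r, addr0, add0r).
  have -> : k.-1./2 = k./2 by rewrite -[in LHS](odd_double_half k) ok add1n /= doubleK.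
  by rewrite ?add0r !(rmorphM (real_complex K)) /=; ring.
by rewrite rmorph0 mulr0 addr0 !(rmorphM (real_complex K)) /=; ring.
Qed.

Lemma cvg_exp_imaginary (t : K) :
  exp_partial_sum ('i * t%:C) @ \oo --> ((cos t)%:C + 'i * (sin t)%:C : K[i]^o).
Proof.
have -> : exp_partial_sum ('i * t%:C) = (fun n =>
    (series (cos_coeff t) n)%:C + 'i *: ((series (sin_coeff t) n)%:C : K[i]^o)).
  apply/funext => n; rewrite /exp_partial_sum /series /= !rmorph_sum /=.
  rewrite scaler_sumr -big_split /=; apply: eq_bigr => k _.
  exact: exp_coeff_imaginary.
apply: cvgD; last apply: cvgZr.
  by apply: cvg_real_complex; rewrite cos.unlock; exact: is_cvg_series_cos_coeff.
by apply: cvg_real_complex; rewrite sin.unlock; exact: is_cvg_series_sin_coeff.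
Qed.

(* Splits [x] into the eigenvectors [(x + U x) / 2] and [(x - U x) / 2] of [U]. *)
Lemma opexp_involution (U : H -> H) (s l m : K[i]) (x : H) :
  linear U -> (forall y, U (U y) = y) ->
  exp_partial_sum s @ \oo --> (l : K[i]^o) ->
  exp_partial_sum (- s) @ \oo --> (m : K[i]^o) ->
  opexp (fun y => s *: U y) x = ((l + m) / 2) *: x + ((l - m) / 2) *: U x.
Proof.
move=> lU UK cl cm; pose p := 2^-1 *: (x + U x); pose q := 2^-1 *: (x - U x).
have Up : U p = p.
  by rewrite /p linear_scale // linear_add // UK addrC.
have Uq : U q = - q.
  by rewrite /q linear_scale // linear_add // linear_opp // UK -scalerN opprB addrC.
have xE : x = p + q.
  rewrite /p /q -scalerDr addrACA subrr addr0 scalerDr -scalerDl.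
  by rewrite (_ : _ + _ = 1) ?scale1r //; field.
(* On [p] and [q] the operator acts as the scalars [s] and [- s], so the series splits into two
   scalar ones. *)
have iterE k : iter k (fun y => s *: U y) x = s ^+ k *: p + (- s) ^+ k *: q.
  elim: k => [|k IH]; first by rewrite !expr0 !scale1r.
  rewrite iterS IH (linear_add _ _ lU) (linear_scale (s ^+ k) _ lU)
    (linear_scale ((- s) ^+ k) _ lU) Up Uq.
  by rewrite scalerDr !(scalerA s) scalerN -scaleNr -mulNr -!exprS.
have -> : ((l + m) / 2) *: x + ((l - m) / 2) *: U x = l *: p + m *: q.
  rewrite /p /q !mulrDl mulNr !scalerDl !scalerA !scalerDr scaleNr scalerN.
  by rewrite addrACA.
apply: (cvg_lim (@norm_hausdorff _ _)).
have -> : (fun n => \sum_(0 <= k < n) (k`!%:R : K[i])^-1 *: iter k (fun y => s *: U y) x) =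
    (fun n => exp_partial_sum s n *: p + exp_partial_sum (- s) n *: q).
  apply/funext => n; rewrite /exp_partial_sum !scaler_suml -big_split /=.
  by apply: eq_bigr => k _; rewrite iterE scalerDr !scalerA.
have cp : (fun n => exp_partial_sum s n *: p) @ \oo --> l *: p.
  exact: (cvgZr_tmp cl).
have cq : (fun n => exp_partial_sum (- s) n *: q) @ \oo --> m *: q.
  exact: (cvgZr_tmp cm).
exact: (cvgD cp cq).
Qed.

End Exponential.

(** * Polar and hyperbolic coordinates *)

Section Parametrization.
Variable K : realType.

Lemma cosh2_sinh2 (t : K) : cosh t ^+ 2 - sinh t ^+ 2 = 1.
Proof.
rewrite /cosh /sinh.
have : expR t * expR (- t) = 1 by rewrite -expRD subrr expR0.
move: (expR t) (expR (- t)) => u v uv.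
have -> : ((u + v) / 2) ^+ 2 - ((u - v) / 2) ^+ 2 = u * v by field.
exact: uv.
Qed.

Lemma polar_coordinates (c d : K) : exists r omega : K,
  [/\ 0 <= r, 0 <= omega < 2 * pi, c = r * cos omega & d = r * sin omega].
Proof.
pose r := Num.sqrt (c ^+ 2 + d ^+ 2).
have cd0 : 0 <= c ^+ 2 + d ^+ 2 by rewrite addr_ge0 ?sqr_ge0.
have rE : r ^+ 2 = c ^+ 2 + d ^+ 2 by rewrite sqr_sqrtr.
have r0 : 0 <= r by rewrite sqrtr_ge0.
have pi0 : 0 < pi :> K := pi_gt0 K.
have [rz|rnz] := eqVneq r 0.
  (* At the origin the angle is arbitrary; 0 is chosen. *)
  exists 0, 0; rewrite lexx mulr_gt0 //; move: rE; rewrite rz expr0n /= => rE.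
  have c0 : c ^+ 2 = 0 by have := sqr_ge0 c; have := sqr_ge0 d; lra.
  have d0 : d ^+ 2 = 0 by lra.
  by split=> //; rewrite mul0r; apply/eqP; rewrite -sqrf_eq0 ?c0 ?d0.
have rp : 0 < r by rewrite lt_def rnz.
pose w := acos (c / r).
have cr2 : 1 - (c / r) ^+ 2 = (d / r) ^+ 2.
  by rewrite !expr_div_n rE; field; rewrite -rE expf_neq0.
have cr1 : -1 <= c / r <= 1.
  rewrite -ler_norml -(@ler_pXn2r _ 2) ?nnegrE // expr1n real_normK ?num_real //.
  by rewrite -subr_ge0 cr2 sqr_ge0.
have cw : cos w = c / r by rewrite /w acosK // in_itv.
have sw : sin w = `|d| / r.
  by rewrite sin_acos // cr2 sqrtr_sqr normrM normfV (gtr0_norm rp).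
have w0 := acos_ge0 cr1; have wpi := acos_lepi cr1.
have [d0|d0] := leP 0 d.
  exists r, w; split => //; rewrite ?cw ?sw.
  - by rewrite w0 /= (le_lt_trans wpi) // ltr_pMl // ltr1n.
  - by rewrite mulrC divfK.
  - by rewrite (ger0_norm d0) mulrC divfK.
(* [acos] covers only [[0, pi]]; for [d < 0] the angle is reflected to [2 pi - w], and [w > 0] keeps
   it strictly below [2 pi]. *)
have w1 : 0 < w.
  rewrite lt_def w0 andbT; apply/negP => /eqP wz.
  move: sw; rewrite wz sin0 => /esym/eqP; rewrite mulf_eq0 normr_eq0 invr_eq0.
  by rewrite (negPf rnz) orbF (lt_eqF d0).
exists r, (2 * pi - w); split => //.
- by rewrite ltrBlDr ltrDl w1 andbT subr_ge0 (le_trans wpi) // ler_pMl // ler1n.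
- by rewrite addrC mulr_natl cosD2pi cosN cw mulrC divfK.
- by rewrite addrC mulr_natl sinD2pi sinN sw (ltr0_norm d0) mulNr opprK mulrC divfK.
Qed.

(** With [r] the polar radius of [(c, d)], the hypothesis reads [(a + r) (a - r) = 1], so
    [chi = ln (a + r)] has exponentials [a + r] and [a - r]. *)
Lemma hyperbolic_coordinates (a c d : K) : 0 < a -> a ^+ 2 = 1 + c ^+ 2 + d ^+ 2 ->
  exists chi omega : K, [/\ 0 <= omega < 2 * pi, a = cosh chi,
    c = sinh chi * cos omega & d = sinh chi * sin omega].
Proof.
move=> a0 aE; have [r [omega [r0 omegaP cE dE]]] := polar_coordinates c d.
have ar : (a + r) * (a - r) = 1.
  have : a ^+ 2 = 1 + r ^+ 2.
    by rewrite aE cE dE !exprMn -addrA -mulrDr cos2Dsin2 mulr1.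
  by move=> h; rewrite mulrC -subr_sqr h addrK.
have ar0 : 0 < a + r by rewrite ltr_wpDr.
have eP : expR (ln (a + r)) = a + r by rewrite lnK // posrE.
have eN : expR (- ln (a + r)) = a - r.
  by rewrite expRN eP -[LHS]mulr1 -ar mulKf // lt0r_neq0.
exists (ln (a + r)), omega.
have -> : cosh (ln (a + r)) = a by rewrite /cosh eP eN; field.
have -> : sinh (ln (a + r)) = r by rewrite /sinh eP eN; field.
by split.
Qed.

End Parametrization.

(** * The operators [C_chi_omega] in closed form *)

Section ChiOmega.
Variables (K : realType) (H : completeNormedModType K[i]).
Variable ip : {dot H for (@Num.conj K[i])}.
Variables (J R : H -> H).
Hypotheses (hJ : fundamental_symmetry ip J) (hR : fundamental_symmetry ip R).
Hypothesis hJR : anticommute J R.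

Lemma R_omegaE (omega : K) x : R_omega J R omega x =
  R ((cos omega)%:C *: x + ('i * (sin omega)%:C) *: J x).
Proof.
have [lJ JK _] := fundamental_symmetryE hJ.
rewrite /R_omega /= (opexp_involution _ lJ JK (@cvg_exp_imaginary K omega)
  (m := (cos omega)%:C - 'i * (sin omega)%:C)); last first.
  have := @cvg_exp_imaginary K (- omega).
  by rewrite cosN sinN !rmorphN !mulrN.
by congr (R (_ *: _ + _ *: _)); field.
Qed.

Lemma R_omega_pauli (omega : K) : R_omega J R omega = pauli_comb J R 0 (cos omega) (sin omega).
Proof.
have [lR _ _] := fundamental_symmetryE hR.
apply/funext => x; rewrite R_omegaE /pauli_comb scale0r add0r.
by rewrite linear_add // !(linear_scale _ _ lR).
Qed.

Lemma C_chi_omegaE (chi omega : K) x : C_chi_omega J R chi omega x =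
  J ((cosh chi)%:C *: x + (sinh chi)%:C *: R_omega J R omega x).
Proof.
have [lU _] := bounded_pauli_comb hJ hR 0 (cos omega) (sin omega).
(* [R_omega] is an involution because [cos^2 + sin^2 = 1] in [pauli_comb_mul] with [a = 0], so its
   exponential has the closed form for involutions. *)
have UK y : R_omega J R omega (R_omega J R omega y) = y.
  rewrite R_omega_pauli; apply/eqP; rewrite -subr_eq0 -oppr_eq0 opprB; apply/eqP.
  have := pauli_comb_mul hJ hR hJR 0 (cos omega) (sin omega) y.
  have -> : pauli_comb J R 0 (- cos omega) (- sin omega) y =
      - pauli_comb J R 0 (cos omega) (sin omega) y.
    by rewrite /pauli_comb !rmorphN !scale0r !add0r mulrN !scaleNr opprD.
  rewrite (linear_opp _ lU) expr0n /= sub0r -opprD cos2Dsin2 rmorphN1 scaleN1r.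
  by move=> /oppr_inj ->; rewrite subrr.
rewrite -R_omega_pauli in lU.
rewrite /C_chi_omega /= (opexp_involution _ lU UK (@cvg_exp_real K chi)
  (m := (expR (- chi))%:C)); last by rewrite -rmorphN; exact: cvg_exp_real.
by rewrite /cosh /sinh !(rmorphM (real_complex K)) rmorphD rmorphB !fmorphV !rmorph_nat.
Qed.

Lemma C_chi_omega_pauli (chi omega : K) : C_chi_omega J R chi omega =
  J \o pauli_comb J R (cosh chi) (sinh chi * cos omega) (sinh chi * sin omega).
Proof.
apply/funext => x; rewrite C_chi_omegaE R_omega_pauli /= /pauli_comb.
rewrite scale0r add0r scalerDr !scalerA addrA !(rmorphM (real_complex K)).
by rewrite [_ * ('i * _)]mulrCA.
Qed.

End ChiOmega.

Theorem theorem4p1 (K : realType) (H : completeNormedModType K[i])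
    (ip : {dot H for (@Num.conj K[i])}) (hH : hilbert ip)
    (J R : H -> H) (S : set (H * H))
    (hJ : fundamental_symmetry ip J) (hR : fundamental_symmetry ip R)
    (hJR : anticommute J R)
    (hS : symmetric_op ip S) (hSd : densely_defined S)
    (hSs : simple_op ip S) (hSdef : defect_numbers_2_2 ip S)
    (hSJ : commute S J) (hSR : commute S R)
    (hU : Upsilon ip J S !=set0) :
  C_symmetries ip J S =
    [set C | exists chi omega : K,
       0 <= omega < 2 * pi /\ C = C_chi_omega J R chi omega] /\
  forall chi omega : K, 0 <= omega < 2 * pi ->
    (forall x, R_omega J R omega x =
       R ((cos omega)%:C *: x + ('i * (sin omega)%:C) *: J x)) /\
    (forall x, C_chi_omega J R chi omega x =
       J ((cosh chi)%:C *: x + (sinh chi)%:C *: R_omega J R omega x)).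
Proof.
have opS := hS.1.
have SJ := commute_preserves hSJ; have SR := commute_preserves hSR.
split; last first.
  by move=> chi omega _; split=> x; [exact: (R_omegaE _ hJ) | exact: (C_chi_omegaE hJ hR hJR)].
apply/seteqP; split=> [C SC | C [chi [omega [_ ->]]]].
- have [a [c [d [a0 aE ->]]]] := C_symmetryP hJ hR hJR opS SJ SR hH hSs hSdef hU SC.
  have [chi [omega [omegaP -> -> ->]]] := hyperbolic_coordinates a0 aE.
  by exists chi, omega; rewrite (C_chi_omega_pauli hJ hR hJR).
- rewrite (C_chi_omega_pauli hJ hR hJR); apply: pauli_comb_C_symmetry => //.
    by rewrite /cosh divr_gt0 // addr_gt0 ?expR_gt0.
  rewrite -addrA !(exprMn _ (sinh chi)) -mulrDr cos2Dsin2 mulr1.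
  by apply/eqP; rewrite -subr_eq cosh2_sinh2.
Qed.
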